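(* Let $B_1,B_2$ be simple skew left braces and let $\alpha:(B_2,\circ)\to\mathrm{Aut}(B_1,+,\circ)$ be a non-trivial group homomorphism. Suppose that at least one of the following two conditions holds: (i) $\alpha$ is not injective and the group $(B_1,\circ)$ has trivial center; (ii) for every $a\in B_2\setminus\{0\}$, $\alpha_a$ is not an inner automorphism of the group $(B_1,\circ)$. Moreover, suppose that $B_1$ is not a trivial skew left brace. Then the semidirect product of skew left braces $B:=B_1\rtimes_\alpha B_2$ is strongly prime and non-simple.
   Context: A skew left brace is a triple $(B,+,\circ)$ such that $(B,+)$ and $(B,\circ)$ are (not necessarily abelian) groups and $a\circ(b+c)=a\circ b-a+a\circ c$ for all $a,b,c\in B$. The two groups share the same identity, denoted $0$. A trivial skew left brace is one with $a\circ b=a+b$ for all $a,b$. For $a\in B$ put $\lambda_a(b):=-a+a\circ b$. An ideal of $B$ is a subset $I\subseteq B$ that is a normal subgroup of $(B,+)$, a normal subgroup of $(B,\circ)$, and satisfies $\lambda_a(I)\subseteq I$ for all $a\in B$. $B$ is simple if its only ideals are $\{0\}$ and $B$. $\mathrm{Aut}(B,+,\circ)$ is the group of bijections of $B$ preserving both operations. A homomorphism is non-trivial if its kernel is a proper subgroup of its domain. Put $a*b:=-a+a\circ b-b$; for $X,Y\subseteq B$, $X*Y$ denotes the additive subgroup generated by all $x*y$ with $x\in X$, $y\in Y$. The operation $*$ on subsets is not associative in general; a $*$-product of ideals means any finite product formed from them using $*$, with any bracketing. $B$ is strongly prime if every $*$-product of any number of non-zero ideals of $B$ is non-zero (i.e.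 $\neq\{0\}$). The semidirect product $B_1\rtimes_\alpha B_2$ is the set $B_1\times B_2$ with operations $(a_1,a_2)+(b_1,b_2)=(a_1+b_1,a_2+b_2)$ and $(a_1,a_2)\circ(b_1,b_2)=(a_1\circ\alpha_{a_2}(b_1),a_2\circ b_2)$; it is a skew left brace. *)

(* Defs.v *)
From HB Require Import structures.
From mathcomp Require Import all_boot.
From mathcomp Require Import boolp classical_sets.

Set Implicit Arguments.
Unset Strict Implicit.
Unset Printing Implicit Defensive.

Local Open Scope classical_set_scope.

(* The group (B, ∘) is the [groupType] structure of B, with the library's    *)
(* [1], [x^-1], [x ^ y] in [group_scope]; [a ∘ b] denotes its product.       *)
Notation "a ∘ b" := (@mul _ a b) (at level 40, left associativity).

(* The additive group need not be abelian, so it cannot be a [zmodType].     *)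
HB.mixin Record isSkewBrace B of Group B := {
  sbzero : B;
  sbopp : B -> B;
  sbadd : B -> B -> B;
  sbaddA : associative sbadd;
  sbadd0 : left_id sbzero sbadd;
  sbaddN : left_inverse sbzero sbopp sbadd;
  sbmulD : forall a b c : B,
    a ∘ sbadd b c = sbadd (sbadd (a ∘ b) (sbopp a)) (a ∘ c)
}.

#[short(type="skewBraceType")]
HB.structure Definition SkewBrace := {B of isSkewBrace B & Group B}.

Declare Scope brace_scope.
Delimit Scope brace_scope with brace.
Bind Scope brace_scope with SkewBrace.sort.
Notation "0" := (@sbzero _) : brace_scope.
Notation "- a" := (@sbopp _ a) : brace_scope.
Notation "a + b" := (@sbadd _ a b) : brace_scope.
Notation "a - b" := (@sbadd _ a (@sbopp _ b)) : brace_scope.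

Local Open Scope brace_scope.

Section SkewBraceTheory.
Variable B : skewBraceType.
Implicit Types a b c : B.

Lemma sbaddNr a : a - a = 0.
Proof.
rewrite -[LHS]sbadd0 -{1}(sbaddN (- a)) -sbaddA.
by rewrite [- a + (a + _)]sbaddA sbaddN sbadd0 sbaddN.
Qed.

Lemma sbaddr0 a : a + 0 = a.
Proof. by rewrite -(sbaddN a) sbaddA sbaddNr sbadd0. Qed.

Lemma sb0E : (0 : B) = 1%g.
Proof.
have h : (1%g : B) ∘ (0 + 0) = 1%g ∘ 0 - 1%g + 1%g ∘ 0 by exact: sbmulD.
move: h; rewrite !mul1g !sbadd0 sbaddr0 => h.
by rewrite -[RHS]sbaddr0 [in RHS]h sbaddNr.
Qed.

End SkewBraceTheory.

Section Ideals.
Variable B : skewBraceType.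
Implicit Types (a b : B) (I X Y : set B) (F : set (set B)).

Definition trivial_brace : Prop := forall a b, a ∘ b = a + b.

Definition lambda a b : B := - a + a ∘ b.

Definition add_subgroup I : Prop :=
  [/\ I 0, forall a b, I a -> I b -> I (a + b) & forall a, I a -> I (- a)].

Definition add_normal I : Prop :=
  add_subgroup I /\ forall a x, I x -> I (a + x - a).

Definition mul_subgroup I : Prop :=
  [/\ I 1%g, forall a b, I a -> I b -> I (a ∘ b) & forall a, I a -> I (a^-1)%g].

Definition mul_normal I : Prop :=
  mul_subgroup I /\ forall a x, I x -> I (a ∘ x ∘ a^-1%g).

Definition ideal I : Prop :=
  [/\ add_normal I, mul_normal I & forall a x, I x -> I (lambda a x)].

Definition simple_brace : Prop :=
  forall I, ideal I -> I = [set 0] \/ I = setT.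

Definition star a b : B := - a + a ∘ b - b.

Definition star_set X Y : set B :=
  smallest add_subgroup [set star x y | x in X & y in Y].

(* The *-products, with arbitrary bracketing, of one or more factors from F. *)
Inductive star_product F : set B -> Prop :=
| star_product_factor X : F X -> star_product F X
| star_product_star X Y :
    star_product F X -> star_product F Y -> star_product F (star_set X Y).

Definition strongly_prime : Prop :=
  forall X, star_product [set I | ideal I /\ I <> [set 0]] X -> X <> [set 0].

End Ideals.

Arguments trivial_brace B : clear implicits.
Arguments simple_brace B : clear implicits.
Arguments strongly_prime B : clear implicits.

Definition group_center (G : groupType) : set G :=
  [set x | forall y, commute x y].
Arguments group_center G : clear implicits.

Definition inner_automorphism (G : groupType) (f : G -> G) : Prop :=
  exists g : G, forall x, f x = (x ^ g)%g.

Definition morphism_kernel (G H : groupType) (f : {multiplicative G -> H}) :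
  set G := [set a | f a = 1%g].

Definition nontrivial_morphism (G H : groupType) (f : {multiplicative G -> H}) :
  Prop := morphism_kernel f `<` setT.

Record brace_aut (B : skewBraceType) := BraceAut {
  brace_aut_fun :> B -> B;
  brace_aut_bij : bijective brace_aut_fun;
  brace_autD : {morph brace_aut_fun : x y / x + y};
  brace_autM : {morph brace_aut_fun : x y / x ∘ y}
}.

Section AutGroup.
Variable B : skewBraceType.
Implicit Types f g h : brace_aut B.

Lemma brace_autP f g : (forall x, f x = g x) -> f = g.
Proof.
case: f g => [f bf fD fM] [g bg gD gM] /= /funext fg; subst g.
by congr BraceAut; exact: Prop_irrelevance.
Qed.

HB.instance Definition _ := gen_eqMixin (brace_aut B).
HB.instance Definition _ := gen_choiceMixin (brace_aut B).

Definition brace_aut_one : brace_aut B :=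
  @BraceAut B id (Bijective (frefl id) (frefl id))
    (fun _ _ => erefl) (fun _ _ => erefl).

Fact brace_aut_comp_D f g : {morph f \o g : x y / x + y}.
Proof. by move=> x y /=; rewrite !brace_autD. Qed.

Fact brace_aut_comp_M f g : {morph f \o g : x y / x ∘ y}.
Proof. by move=> x y /=; rewrite !brace_autM. Qed.

Definition brace_aut_mul f g : brace_aut B :=
  BraceAut (bij_comp (brace_aut_bij f) (brace_aut_bij g))
    (brace_aut_comp_D f g) (brace_aut_comp_M f g).

Fact brace_aut_inv_exists f : exists g : B -> B, cancel f g /\ cancel g f.
Proof. by case: (brace_aut_bij f) => g fK gK; exists g. Qed.

Definition brace_aut_inv_fun f : B -> B := projT1 (cid (brace_aut_inv_exists f)).

Fact brace_aut_invK f : cancel f (brace_aut_inv_fun f).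
Proof. by rewrite /brace_aut_inv_fun; case: cid => g []. Qed.

Fact brace_autK f : cancel (brace_aut_inv_fun f) f.
Proof. by rewrite /brace_aut_inv_fun; case: cid => g []. Qed.

Fact brace_aut_inv_D f : {morph brace_aut_inv_fun f : x y / x + y}.
Proof.
move=> x y; apply: (can_inj (brace_aut_invK f)).
by rewrite brace_autD !brace_autK.
Qed.

Fact brace_aut_inv_M f : {morph brace_aut_inv_fun f : x y / x ∘ y}.
Proof.
move=> x y; apply: (can_inj (brace_aut_invK f)).
by rewrite brace_autM !brace_autK.
Qed.

Definition brace_aut_inv f : brace_aut B :=
  BraceAut (Bijective (@brace_autK f) (@brace_aut_invK f))
    (@brace_aut_inv_D f) (@brace_aut_inv_M f).

Fact brace_aut_mulA : associative brace_aut_mul.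
Proof. by move=> f g h; exact: brace_autP. Qed.
Fact brace_aut_mul1 : left_id brace_aut_one brace_aut_mul.
Proof. by move=> f; exact: brace_autP. Qed.
Fact brace_aut_mulr1 : right_id brace_aut_one brace_aut_mul.
Proof. by move=> f; exact: brace_autP. Qed.
Fact brace_aut_mulV : left_inverse brace_aut_one brace_aut_inv brace_aut_mul.
Proof. by move=> f; apply: brace_autP => x; exact: brace_aut_invK. Qed.
Fact brace_aut_mulrV : right_inverse brace_aut_one brace_aut_inv brace_aut_mul.
Proof. by move=> f; apply: brace_autP => x; exact: brace_autK. Qed.

HB.instance Definition _ := isGroup.Build (brace_aut B)
  brace_aut_mulA brace_aut_mul1 brace_aut_mulr1 brace_aut_mulV brace_aut_mulrV.

End AutGroup.

(* The operations of the semidirect product are [sd_add] and [sd_mul] below. *)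
Definition semidirect (B1 B2 : skewBraceType)
  (alpha : {multiplicative B2 -> brace_aut B1}) : Type := (B1 * B2)%type.

Section Semidirect.
Variables (B1 B2 : skewBraceType) (alpha : {multiplicative B2 -> brace_aut B1}).
Local Notation S := (semidirect alpha).
Implicit Types u v w : S.

HB.instance Definition _ := Choice.copy S (B1 * B2)%type.

Definition sd_zero : S := (0, 0).
Definition sd_opp u : S := (- u.1, - u.2).
Definition sd_add u v : S := (u.1 + v.1, u.2 + v.2).
Definition sd_one : S := (1%g, 1%g).
Definition sd_inv u : S := (alpha (u.2^-1)%g (u.1^-1)%g, (u.2^-1)%g).
Definition sd_mul u v : S := (u.1 ∘ alpha u.2 v.1, u.2 ∘ v.2).

Let alphaM a b x : alpha (a ∘ b) x = alpha a (alpha b x).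
Proof. by rewrite gmulfM. Qed.
Let alpha1 x : alpha 1%g x = x.
Proof.
by rewrite (_ : alpha 1%g = 1%g) //; apply: (mulgI (alpha 1%g));
  rewrite -gmulfM !mulg1.
Qed.
Let aut1 (f : brace_aut B1) : f 1%g = 1%g.
Proof. by apply: (mulgI (f 1%g)); rewrite -brace_autM !mulg1. Qed.

Fact sd_mulA : associative sd_mul.
Proof. by move=> u v w; rewrite /sd_mul /= brace_autM alphaM !mulgA. Qed.
Fact sd_mul1 : left_id sd_one sd_mul.
Proof. by case=> a b; rewrite /sd_mul /= alpha1 !mul1g. Qed.
Fact sd_mulr1 : right_id sd_one sd_mul.
Proof. by case=> a b; rewrite /sd_mul /= aut1 !mulg1. Qed.
Fact sd_mulV : left_inverse sd_one sd_inv sd_mul.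
Proof. by case=> a b; rewrite /sd_mul /= -brace_autM !mulVg aut1. Qed.
Fact sd_mulrV : right_inverse sd_one sd_inv sd_mul.
Proof. by case=> a b; rewrite /sd_mul /= -alphaM !mulgV alpha1 mulgV. Qed.

HB.instance Definition _ :=
  isGroup.Build S sd_mulA sd_mul1 sd_mulr1 sd_mulV sd_mulrV.
Fact sd_addA : associative sd_add.
Proof. by move=> u v w; rewrite /sd_add /= !sbaddA. Qed.
Fact sd_add0 : left_id sd_zero sd_add.
Proof. by case=> a b; rewrite /sd_add /= !sbadd0. Qed.
Fact sd_addN : left_inverse sd_zero sd_opp sd_add.
Proof. by case=> a b; rewrite /sd_add /= !sbaddN. Qed.
Fact sd_mulD u v w :
  u ∘ sd_add v w = sd_add (sd_add (u ∘ v) (sd_opp u)) (u ∘ w).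
Proof.
by case: u v w => [a b] [c d] [e f]; congr pair; rewrite /= ?brace_autD sbmulD.
Qed.

HB.instance Definition _ :=
  isSkewBrace.Build S sd_addA sd_add0 sd_addN sd_mulD.

End Semidirect.

(* Main.v *)
Require Import Defs.
From HB Require Import structures.
From mathcomp Require Import all_boot.
From mathcomp Require Import boolp classical_sets.

(** Every non-zero ideal I of the semidirect product contains J = B1 x 0. Since
    J is isomorphic to the simple brace B1, otherwise I and J meet trivially, so
    they centralize each other for ∘, and (a, b) in I forces alpha_b to be
    conjugation by a; b = 0 only for the zero element. This excludes (ii). Under
    (i), I projects onto B2, and an element of I above some b <> 0 in ker alpha
    is (0, b) because B1 has trivial center. Hence the ideal {b | (0, b) in I}
    of B2 is non-zero, thus everything, and alpha is trivial. Finally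
    J * J = J, because B1 * B1 is a non-zero ideal of B1, so every *-product of
    non-zero ideals contains J. *)

Local Open Scope classical_set_scope.
Local Open Scope brace_scope.

(** * Identities for [lambda] and [star], and the ideal [B * B] *)

Section BraceTheory.
Variable B : skewBraceType.
Implicit Types (a b c x y : B) (I : set B).

Lemma sbaddKr a b : - a + (a + b) = b.
Proof. by rewrite sbaddA sbaddN sbadd0. Qed.

Lemma sbaddNKr a b : a + (- a + b) = b.
Proof. by rewrite sbaddA sbaddNr sbadd0. Qed.

Lemma sbaddI a b c : a + b = a + c -> b = c.
Proof. by move=> e; rewrite -(sbaddKr a b) e sbaddKr. Qed.

Lemma sbaddNU a b : a + b = 0 -> b = - a.
Proof. by move=> e; apply: (@sbaddI a); rewrite e sbaddNr. Qed.

Lemma sboppK a : - - a = a.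
Proof. by apply: esym; apply: sbaddNU; exact: sbaddN. Qed.

Lemma sbopp0 : - 0 = 0 :> B.
Proof. by apply: esym; apply: sbaddNU; exact: sbadd0. Qed.

Lemma sboppD a b : - (a + b) = - b + - a.
Proof. by apply: esym; apply: sbaddNU; rewrite -sbaddA sbaddNKr sbaddNr. Qed.

Lemma sbmulE a b : a ∘ b = a + lambda a b.
Proof. by rewrite /lambda sbaddNKr. Qed.

Lemma lambdaD a b c : lambda a (b + c) = lambda a b + lambda a c.
Proof. by rewrite /lambda sbmulD !sbaddA. Qed.

Lemma lambda0 a : lambda a 0 = 0.
Proof. by rewrite /lambda sb0E mulg1 sbaddN sb0E. Qed.

Lemma lambdaN a b : lambda a (- b) = - lambda a b.
Proof. by apply: sbaddNU; rewrite -lambdaD sbaddNr lambda0. Qed.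

Lemma lambdaM a b c : lambda (a ∘ b) c = lambda a (lambda b c).
Proof.
by rewrite {3}/lambda lambdaD lambdaN /lambda sboppD sboppK -!sbaddA sbaddNKr mulgA.
Qed.

Lemma lambdaV a : lambda a a^-1%g = - a.
Proof. by rewrite /lambda mulgV -sb0E sbaddr0. Qed.

Lemma starE a b : star a b = lambda a b - b.
Proof. by []. Qed.

(** [lambda] is an action of (B, ∘), so [lambda c] after [lambda a] is [lambda (c ∘ a ∘ c^-1)] after
    [lambda c]. *)
Lemma lambda_star c a b :
  lambda c (star a b) = star (c ∘ a ∘ c^-1%g) (lambda c b).
Proof. by rewrite !starE lambdaD lambdaN -!lambdaM -!mulgA mulVg mulg1. Qed.

Lemma starDr a b c : star a (b + c) = star a b + (b + star a c - b).
Proof. by rewrite !starE lambdaD sboppD -!sbaddA sbaddKr. Qed.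

(** Since x ∘ y = x + star x y + y, the ∘-conjugate of x by c is the additive conjugate by c of
    [lambda c (x + star x c^-1)]; one-sided closure under [star] thus yields normality for ∘. *)
Lemma ideal_of_star I : add_normal I ->
  (forall a x, I x -> I (lambda a x)) -> (forall a x, I x -> I (star x a)) ->
  ideal I.
Proof.
move=> nI lI sI; have [[I0 ID IN] IJ] := nI; split=> //; split.
  split; first by rewrite -sb0E.
    by move=> a b Ia Ib; rewrite sbmulE; apply: ID => //; exact: lI.
  move=> a Ia; rewrite -(sboppK (a^-1)%g) -(lambdaV a^-1%g) invgK.
  by apply: IN; exact: lI.
move=> c x Ix.
have -> : c ∘ x ∘ c^-1%g = c + lambda c (x + star x c^-1%g) - c.
  rewrite starE -(lambdaV c) -sbaddA -lambdaD -!sbaddA sbaddN sbaddr0.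
  by rewrite -mulgA (sbmulE x) sbmulE sbaddNKr.
by apply: IJ; apply: lI; apply: ID => //; exact: sI.
Qed.

Lemma add_subgroup_star_set (X Y : set B) : add_subgroup (star_set X Y).
Proof.
split; first by move=> Z [[]].
- move=> a b Ha Hb Z HZ; have [[_ ZD _] _] := HZ.
  by apply: ZD; [exact: Ha|exact: Hb].
- by move=> a Ha Z HZ; have [[_ _ ZN] _] := HZ; apply: ZN; exact: Ha.
Qed.

Lemma mem_star_set (X Y : set B) x y : X x -> Y y -> star_set X Y (star x y).
Proof. by move=> Xx Yy Z [_]; apply; exists x => //; exists y. Qed.

Lemma star_set_ind (X Y Z : set B) : add_subgroup Z ->
  (forall x y, X x -> Y y -> Z (star x y)) -> star_set X Y `<=` Z.
Proof.
by move=> sZ hZ; apply: smallest_sub => // _ [x Xx [y Yy <-]]; exact: hZ.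
Qed.

(** It suffices to treat generators: [starDr] expresses an additive conjugate of a star through two
    stars, and [lambda_star] sends stars to stars. *)
Lemma ideal_star_setT : ideal (star_set [set: B] setT).
Proof.
have [S0 SD SN] := add_subgroup_star_set [set: B] setT.
have SS x y : star_set [set: B] setT (star x y) by exact: mem_star_set.
apply: ideal_of_star => //.
- split=> // c; apply: star_set_ind.
    split; first by rewrite sbaddr0 sbaddNr.
      move=> a b Ha Hb; have -> : c + (a + b) - c = (c + a - c) + (c + b - c).
        by rewrite -!sbaddA sbaddKr.
      exact: SD.
    move=> a Ha; have -> : c + - a - c = - (c + a - c).
      by rewrite !sboppD sboppK !sbaddA.
    exact: SN.
  move=> x y _ _; have -> : c + star x y - c = - star x c + star x (c + y).
    by rewrite starDr sbaddKr.
  by apply: SD => //; exact: SN.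
- move=> c; apply: star_set_ind.
    split; first by rewrite lambda0.
      by move=> a b Ha Hb; rewrite lambdaD; exact: SD.
    by move=> a Ha; rewrite lambdaN; exact: SN.
  by move=> x y _ _; rewrite lambda_star.
Qed.

(** If [B * B] is zero, every [lambda a] is the identity, so ∘ coincides with +. *)
Lemma simple_star_setT :
  simple_brace B -> ~ trivial_brace B -> star_set [set: B] setT = setT.
Proof.
move=> sB ntB; have [S0|//] := sB _ ideal_star_setT.
case: ntB => a b; rewrite sbmulE; congr (_ + _).
have : star_set [set: B] setT (star a b) by exact: mem_star_set.
rewrite S0 starE /= => e.
by rewrite -(sbaddr0 (lambda a b)) -(sbaddN b) sbaddA e sbadd0.
Qed.

End BraceTheory.

(** * Ideals of the semidirect product and their traces on the factors *)

Section SemidirectIdeals.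
Variables (B1 B2 : skewBraceType) (alpha : {multiplicative B2 -> brace_aut B1}).
Local Notation S := (semidirect alpha).
Implicit Types (I X Y : set S).

Lemma sdaddE (u v : S) : u + v = (u.1 + v.1, u.2 + v.2) :> S.
Proof. by []. Qed.

Lemma sdoppE (u : S) : - u = (- u.1, - u.2) :> S.
Proof. by []. Qed.

Lemma sdmulE (u v : S) : u ∘ v = (u.1 ∘ alpha u.2 v.1, u.2 ∘ v.2) :> S.
Proof. by []. Qed.

Lemma sdinvE (u : S) :
  (u^-1)%g = (alpha (u.2^-1)%g (u.1^-1)%g, (u.2^-1)%g) :> S.
Proof. by []. Qed.

Definition sdE := (sdaddE, sdoppE, sdmulE, sdinvE).

Lemma brace_aut1 (B : skewBraceType) (f : brace_aut B) : f 1%g = 1%g.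
Proof. by apply: (mulgI (f 1%g)); rewrite -brace_autM !mulg1. Qed.

Lemma alpha_one : alpha 1%g = 1%g.
Proof. by apply: (mulgI (alpha 1%g)); rewrite -gmulfM !mulg1. Qed.

Lemma alpha1E x : alpha 1%g x = x.
Proof. by rewrite alpha_one. Qed.

Definition sd_left : set S := [set u | u.2 = 0].

Lemma ideal_sd_left : ideal sd_left.
Proof.
rewrite /sd_left; split.
- split; first split=> //=.
  + by move=> a b /= -> ->; rewrite sbadd0.
  + by move=> a /= ->; rewrite sbopp0.
  + by move=> a x /= ->; rewrite sbaddr0 sbaddNr.
- split; first split=> //=.
  + by rewrite sb0E.
  + by move=> a b /= -> ->; rewrite sb0E mulg1.
  + by move=> a /= ->; rewrite sb0E invg1.
  + by move=> a x /= ->; rewrite sb0E mulg1 mulgV.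
- by move=> a x /= ->; rewrite sb0E mulg1 sbaddN sb0E.
Qed.

(** Preimage under a -> (a, 0), a morphism because [alpha 1] is the identity map. *)
Lemma ideal_restr_left I : ideal I -> ideal [set a : B1 | I (a, 0)].
Proof.
move=> [[[I0 ID IN] IJ] [[I1 IM IV] IC] IL].
split.
- split; first split=> //=.
  + by move=> a b /= Ha Hb; have := ID _ _ Ha Hb; rewrite !sdE /= sbadd0.
  + by move=> a /= Ha; have := IN _ Ha; rewrite !sdE /= sbopp0.
  + by move=> a x /= Hx; have := IJ (a, 0) _ Hx; rewrite !sdE /= sbaddr0 sbaddNr.
- split; first split=> //=.
  + by rewrite sb0E.
  + by move=> a b /= Ha Hb; have := IM _ _ Ha Hb;
      rewrite !sdE /= !sb0E alpha1E mulg1.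
  + by move=> a /= Ha; have := IV _ Ha; rewrite !sdE /= !sb0E invg1 alpha1E.
  + by move=> a x /= Hx; have := IC (a, 0) _ Hx;
      rewrite !sdE /= !sb0E !invg1 !mulg1 !alpha1E.
- by move=> a x /= Hx; have := IL (a, 0) _ Hx;
    rewrite /lambda !sdE /= !sb0E mulg1 alpha1E -sb0E sbaddN.
Qed.

(** Preimage under b -> (0, b), a morphism because automorphisms fix the identity. *)
Lemma ideal_restr_right I : ideal I -> ideal [set b : B2 | I (0, b)].
Proof.
move=> [[[I0 ID IN] IJ] [[I1 IM IV] IC] IL].
split.
- split; first split=> //=.
  + by move=> a b /= Ha Hb; have := ID _ _ Ha Hb; rewrite !sdE /= sbadd0.
  + by move=> a /= Ha; have := IN _ Ha; rewrite !sdE /= sbopp0.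
  + by move=> a x /= Hx; have := IJ (0, a) _ Hx; rewrite !sdE /= sbaddr0 sbaddNr.
- split; first split=> //=.
  + by rewrite sb0E.
  + by move=> a b /= Ha Hb; have := IM _ _ Ha Hb;
      rewrite !sdE /= !sb0E brace_aut1 mulg1.
  + by move=> a /= Ha; have := IV _ Ha; rewrite !sdE /= !sb0E invg1 brace_aut1.
  + by move=> a x /= Hx; have := IC (0, a) _ Hx;
      rewrite !sdE /= !sb0E invg1 !brace_aut1 !mulg1.
- by move=> a x /= Hx; have := IL (0, a) _ Hx;
    rewrite /lambda !sdE /= !sb0E brace_aut1 mulg1 -sb0E sbaddN.
Qed.

(** Image under the projection onto B2, a surjective morphism; [a] is lifted to (0, a). *)
Lemma ideal_proj_right I : ideal I -> ideal [set b : B2 | exists a, I (a, b)].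
Proof.
move=> [[[I0 ID IN] IJ] [[I1 IM IV] IC] IL].
split.
- split; first split=> /=.
  + by exists 0.
  + by move=> a b [x Hx] [y Hy]; eexists; exact: (ID _ _ Hx Hy).
  + by move=> a [x Hx]; eexists; exact: (IN _ Hx).
  + by move=> a b [x Hx]; eexists; exact: (IJ (0, a) _ Hx).
- split; first split=> /=.
  + by exists 1%g.
  + by move=> a b [x Hx] [y Hy]; eexists; exact: (IM _ _ Hx Hy).
  + by move=> a [x Hx]; eexists; exact: (IV _ Hx).
  + by move=> a b [x Hx]; eexists; exact: (IC (0, a) _ Hx).
- by move=> a b [x Hx]; eexists; exact: (IL (0, a) _ Hx).
Qed.

(** The ∘-commutator of (x, 0) and (a, b) lies in I and has second coordinate 0, so it is trivial;
    the first coordinates of the two products then agree. *)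
Lemma ideal_alpha_conj I a b : ideal I -> (forall x, I (x, 0) -> x = 0) ->
  I (a, b) -> forall x, alpha b x = (x ^ a)%g.
Proof.
move=> [_ [[_ IM IV] IC] _] I0 Iab x.
have comm : ((x, 0) : S) ∘ (a, b) = ((a, b) : S) ∘ (x, 0).
  have := IM _ _ (IC (x, 0) _ Iab) (IV _ Iab).
  set c := (X in I X) => Ic.
  have c2 : c.2 = 0 by rewrite /c !sdE /= !sb0E invg1 mul1g mulg1 mulgV.
  have c1 : c.1 = 0 by apply: I0; rewrite -c2 -surjective_pairing.
  have /(congr1 (fun d => d ∘ ((a, b) : S) ∘ (x, 0))) : c = 1%g.
    by rewrite (surjective_pairing c) c1 c2 !sb0E.
  by rewrite /c mul1g !mulgVK.
move/(congr1 fst): comm; rewrite /= sb0E alpha1E => xa.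
by rewrite conjgE xa mulKg.
Qed.

(** The star of (x, 0) and (y, 0) is (star x y, 0), so generators of [B1 * B1] lift into
    [star_set X Y]. *)
Lemma sub_sd_left_star X Y : star_set [set: B1] setT = setT ->
  sd_left `<=` X -> sd_left `<=` Y -> sd_left `<=` star_set X Y.
Proof.
move=> ST JX JY [a b]; rewrite /sd_left /= => ->.
have : star_set [set: B1] setT a by rewrite ST.
have [S0 SD SN] := add_subgroup_star_set _ X Y.
move: a; apply: star_set_ind.
  split=> //= [x y Hx Hy|x Hx].
    by have := SD _ _ Hx Hy; rewrite !sdE /= sbadd0.
  by have := SN _ Hx; rewrite !sdE /= sbopp0.
move=> x y _ _ /=.
have := @mem_star_set S X Y (x, 0) (y, 0) (JX (x, 0) erefl) (JY (y, 0) erefl).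
by rewrite /star !sdE /= !sb0E alpha1E mulg1 -sb0E sbaddN sbopp0 sbaddr0.
Qed.

(** * Non-zero ideals contain B1 x 0; strong primeness and non-simplicity *)

Hypotheses (simple1 : simple_brace B1) (simple2 : simple_brace B2).
Hypothesis alphaN1 : nontrivial_morphism alpha.
Hypothesis alphaP : (~ injective alpha /\ group_center B1 = [set 1%g]) \/
  (forall a : B2, a <> 0 -> ~ inner_automorphism (alpha a)).

Lemma sd_left_sub_ideal I : ideal I -> I <> [set 0] -> sd_left `<=` I.
Proof.
move=> idI I_neq0.
have [R0|RT] := simple1 _ (ideal_restr_left _ idI); last first.
  by move=> [a b]; rewrite /sd_left /= => ->; rewrite -[I _]/([set a | I (a, 0)] a) RT.
have {}R0 x : I (x, 0) -> x = 0.
  by move=> Ix; suff : [set 0] x by []; rewrite -R0.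
have conjI a b : I (a, b) -> forall x, alpha b x = (x ^ a)%g.
  exact: ideal_alpha_conj.
have I0 : I 0 by case: idI => -[[]].
(* Otherwise I would lie in B1 x 0, which it meets trivially. *)
have [a [b [Iab b0]]] : exists a b, I (a, b) /\ b <> 0.
  apply: contrapT => nI; apply: I_neq0; apply/seteqP; split=> [[a b] Iab|_ ->//].
  have b0 : b = 0 by apply: contrapT => b0; apply: nI; exists a, b.
  by rewrite b0 in Iab *; rewrite (R0 _ Iab).
case: alphaP => [[ninj Z1]|/(_ b b0)[]]; last by exists a; exact: conjI.
(* The witness is the ∘-quotient of two distinct elements with the same image. *)
have [c c0 ac] : exists2 c : B2, c <> 0 & alpha c = 1%g.
  apply: contrapT => nc; apply: ninj => c d e; apply: contrapT => cd; apply: nc.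
  exists (c^-1 ∘ d)%g; last by rewrite gmulfM -e -gmulfM mulVg alpha_one.
  by rewrite sb0E => /(congr1 (mul c)); rewrite mulVKg mulg1 => /esym.
have [P0|PT] := simple2 _ (ideal_proj_right _ idI).
  by case: b0; suff : [set 0] b by []; rewrite -P0; exists a.
have [z Izc] : exists z, I (z, c).
  by rewrite -[exists z, _]/([set d | exists z, I (z, d)] c) PT.
(* [alpha c] is both the identity and conjugation by [z], so [z] is central. *)
have z0 : z = 0.
  suff : group_center B1 z by rewrite Z1 sb0E.
  move=> x; have := conjI _ _ Izc x; rewrite ac conjgE => e.
  by rewrite /commute {1}[x in z ∘ x]e mulVKg.
have [K0|KT] := simple2 _ (ideal_restr_right _ idI).
  by case: c0; suff : [set 0] c by []; rewrite -K0 /= -z0.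
(* Every (0, d) is now in I, so [alpha d] is conjugation by the identity, even for a [d] outside the
   kernel. *)
case: alphaN1 => _; case=> d _; apply: brace_autP => x.
by rewrite (conjI 0 d) ?sb0E ?conjg1// -sb0E -[I _]/([set b | I (0, b)] d) KT.
Qed.

Hypothesis ntriv1 : ~ trivial_brace B1.

Lemma brace_neq0 : exists a : B1, a <> 0.
Proof.
apply: contrapT => n0; apply: ntriv1 => a b.
have z (c : B1) : c = 0 by apply: contrapT => c0; apply: n0; exists c.
by rewrite (z (a ∘ b)) (z (a + b)).
Qed.

(** Induction on the bracketing, with containment of B1 x 0 as the invariant. *)
Lemma sd_strongly_prime : strongly_prime S.
Proof.
move=> X pX; have JX : sd_left `<=` X.
  elim: pX => [{}X [idX X0]|{}X Y _ JX _ JY]; first exact: sd_left_sub_ideal.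
  by apply: sub_sd_left_star => //; exact: simple_star_setT.
have [a a0] := brace_neq0.
move=> X0; apply: a0.
by have := JX (a, 0) erefl; rewrite X0 => -[].
Qed.

(** The ideal B1 x 0 is non-zero because B1 is, and proper because an element of B2 outside the
    kernel of [alpha] is non-zero. *)
Lemma sd_nonsimple : ~ simple_brace S.
Proof.
move=> /(_ _ ideal_sd_left)[J0|JT].
  have [a] := brace_neq0; apply.
  have : sd_left (a, 0) by [].
  by rewrite J0 => -[].
case: alphaN1 => _; case=> d _.
have : sd_left (0, d) by rewrite JT.
by rewrite /sd_left /morphism_kernel /= => ->; rewrite sb0E alpha_one.
Qed.

End SemidirectIdeals.

Theorem theorem21 (B1 B2 : skewBraceType)
  (alpha : {multiplicative B2 -> brace_aut B1}) :
  simple_brace B1 -> simple_brace B2 ->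
  nontrivial_morphism alpha ->
  (~ injective alpha /\ group_center B1 = [set 1%g]) \/
  (forall a : B2, a <> 0 -> ~ inner_automorphism (alpha a)) ->
  ~ trivial_brace B1 ->
  strongly_prime (semidirect alpha) /\ ~ simple_brace (semidirect alpha).
Proof.
move=> simple1 simple2 alphaN1 alphaP ntriv1; split.
  exact: sd_strongly_prime.
exact: sd_nonsimple.
Qed.
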